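(* Let $n$ and $d$ be integers with $d\geq 3$ and $3d\leq n\leq 4d-3$. Then $\gamma_t(K_{n,d})=3$, where $K_{n,d}$ is the circular complete graph.
   Context: For positive integers $n,d$ with $n\geq 2d$, the circular complete graph $K_{n,d}$ is the (simple, undirected) graph with vertex set $\{v_0,v_1,\ldots,v_{n-1}\}$ in which $v_i$ is adjacent to $v_j$ if and only if $d\leq |i-j|\leq n-d$. (It is not a complete bipartite graph.) A set $S$ of vertices in a graph $G=(V,E)$ is called a total dominating set if every vertex $v\in V$ (including those in $S$) is adjacent to some element of $S$. The total domination number $\gamma_t(G)$ is the minimum cardinality of a total dominating set of $G$. *)

(* Defs.v *)
From mathcomp Require Import all_boot all_order all_algebra.

Set Implicit Arguments.
Unset Strict Implicit.
Unset Printing Implicit Defensive.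

(* A graph on the finite vertex type T is given by its adjacency relation. *)

(* The vertex v_i is the ordinal i : 'I_n.  `|i - j|%N is the absolute
   difference of integers; n - d is truncated, which is harmless as the graph
   is only considered for n >= 2d. *)
Definition circular_complete (n d : nat) : rel 'I_n :=
  fun i j => (d <= `|i - j| <= n - d)%N.

Lemma circular_complete_sym n d : symmetric (@circular_complete n d).
Proof. by move=> i j; rewrite /circular_complete distnC. Qed.

Lemma circular_complete_irrefl n d :
  0 < d -> irreflexive (@circular_complete n d).
Proof. by move=> d_gt0 i; rewrite /circular_complete distnn leqNgt d_gt0. Qed.

Definition total_dominating (T : finType) (e : rel T) (S : {set T}) : bool :=
  [forall v : T, exists u in S, e v u].

(* The minimum is over all total dominating sets.  One exists iff the graph has
   no isolated vertex, iff the whole vertex set is one; otherwise gamma_t has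
   the junk value #|T|. *)
Definition gamma_t (T : finType) (e : rel T) : nat :=
  #|[arg min_(S < [set: T] | total_dominating e S) #|S|]|.

Lemma gamma_tP (T : finType) (e : rel T) (k : nat) :
  (forall v, exists u, e v u) ->
  gamma_t e = k <->
  (exists2 S : {set T}, total_dominating e S & #|S| = k) /\
  (forall S : {set T}, total_dominating e S -> k <= #|S|).
Proof.
move=> eP; have tdT : total_dominating e [set: T].
  apply/forallP => v; have [u evu] := eP v.
  by apply/existsP; exists u; rewrite in_setT.
rewrite /gamma_t; case: arg_minnP => // S tdS minS; split.
  by move=> <-; split; [exists S | exact: minS].
move=> [[S' tdS' <-] minS']; apply/eqP.
by rewrite eqn_leq minS // minS'.
Qed.

(* Main.v *)
Require Import Defs.
From mathcomp Require Import all_boot all_order all_algebra.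
From mathcomp Require Import zify.

(** Place the vertices on a cycle of length [n]: [v_i] and [v_j] are adjacent
    exactly when their cyclic distance is at least [d], so the non-neighbours
    of a vertex form an arc of [2 * d - 1] vertices centred at it.

    Three vertices suffice because [3 * d <= n] allows the choice
    [0, d, 2 * d], whose neighbourhoods together go round the whole cycle
    ([three_vertices_dominate]).

    Two vertices do not suffice: when [n < 2 * (2 * d - 1)] the arcs of
    non-neighbours of any two vertices are too long to be disjoint, and a
    vertex common to both is adjacent to neither
    ([common_nonneighbour], [total_dominating_card_ge3]). *)

(** The two ways round the cycle from [a] to [b] have total length
    [n <= 4 * d - 3], so one of them has length at most [2 * d - 2]; its
    midpoint, rounded to a vertex, is at distance at most [d - 1] from both
    ends. *)
Lemma common_nonneighbour {n d : nat} (a b : 'I_n) :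
  n + 3 <= 4 * d ->
  exists v : 'I_n,
    ~~ circular_complete d v a && ~~ circular_complete d v b.
Proof.
move=> hn; wlog le_ab : a b / a <= b => [IH|].
  case: (leqP a b) => [|/ltnW] /IH // [v]; rewrite andbC => nvab.
  by exists v.
have [lt_a lt_b] := (ltn_ord a, ltn_ord b); rewrite /circular_complete.
have [near|far] := leqP (b - a + 2) (2 * d).
  have lt_v : (a + b)./2 < n by lia.
  by exists (Ordinal lt_v) => /=; lia.
(* The way of length at most 2 * d - 2 is now the one that passes from n - 1
   to 0; on which side of that step its midpoint lies depends on the sign of
   a + b - n. *)
have [lt_abn|ge_abn] := ltnP (a + b) n.
  have lt_v : (a + b + n)./2 < n by lia.
  by exists (Ordinal lt_v) => /=; lia.
have lt_v : (a + b - n)./2 < n by lia.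
by exists (Ordinal lt_v) => /=; lia.
Qed.

Lemma card_le2_subset {T : finType} (x : T) {S : {set T}} :
  #|S| <= 2 -> exists a b, S \subset [set a; b].
Proof.
rewrite leq_eqVlt ltnS leq_eqVlt ltnS leqn0.
case/or3P => [/cards2P[a [b [_ ->]]]|/cards1P[a ->]|/eqP/cards0_eq->].
- by exists a, b.
- by exists a, a; rewrite subsetUl.
- by exists x, x; rewrite sub0set.
Qed.

Lemma total_dominating_card_ge3 (n d : nat) (S : {set 'I_n}) :
  0 < n -> n + 3 <= 4 * d ->
  total_dominating (@circular_complete n d) S -> 2 < #|S|.
Proof.
move=> n_gt0 hn /forallP tdS; rewrite ltnNge; apply/negP.
case/(card_le2_subset (Ordinal n_gt0)) => a [b /subsetP sSab].
have [v /andP[nva nvb]] := common_nonneighbour a b hn.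
have /existsP[u /andP[/sSab]] := tdS v.
by case/set2P=> ->; apply/negP.
Qed.

(** Going round the cycle, the neighbourhoods of [0], [d] and [2 * d] are the
    arcs from [d] to [n - d], from [2 * d] through [n - 1] to [0], and from
    [3 * d] through [n - 1] to [d]. They leave no gap since
    [2 * d <= n - d]. *)
Lemma three_vertices_dominate {n d : nat} :
  0 < d -> 3 * d <= n ->
  exists2 S : {set 'I_n},
    total_dominating (@circular_complete n d) S & #|S| = 3.
Proof.
move=> d_gt0 hn.
have [lt0 lt1 lt2] : [/\ 0 < n, d < n & 2 * d < n] by split; lia.
pose x0 := Ordinal lt0; pose x1 := Ordinal lt1; pose x2 := Ordinal lt2.
exists [set x0; x1; x2].
  apply/forallP => v; apply/existsP; have lt_v := ltn_ord v.
  have [le_vd|gt_vd] := leqP v d.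
    exists x2; rewrite !inE eqxx ?orbT /=.
    by rewrite /circular_complete /=; lia.
  have [le_vnd|gt_vnd] := leqP v (n - d).
    exists x0; rewrite !inE eqxx ?orbT /=.
    by rewrite /circular_complete /=; lia.
  exists x1; rewrite !inE eqxx ?orbT /=.
  by rewrite /circular_complete /=; lia.
rewrite setUC cardsU1 cards2 !inE -!val_eqE /=.
by have [-> -> ->] : [/\ (2 * d == 0) = false, (2 * d == d) = false
                       & (0 == d) = false] by split; lia.
Qed.

Theorem theorem6 (n d : nat) (hd : 3 <= d) (hn : 3 * d <= n <= 4 * d - 3) :
  gamma_t (@circular_complete n d) = 3.
Proof.
have d_gt0 : 0 < d by lia.
have le_n : 3 * d <= n by lia.
have n_le : n + 3 <= 4 * d by lia.
have n_gt0 : 0 < n by lia.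
have [S3 tdS3 cardS3] := three_vertices_dominate d_gt0 le_n.
apply/gamma_tP => [v|].
  by have /existsP[u /andP[_ evu]] := forallP tdS3 v; exists u.
split; first by exists S3.
by move=> S; apply: total_dominating_card_ge3.
Qed.
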